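(* Let $m\in\mathbb{N}$, let $g:\{0,1\}^n\to\{0,1\}$ be a non-constant monotone function, and let $\mathrm{eq}:\{0,1\}^t\times\{0,1\}^t\to\{0,1\}$ be the equality function on strings of length $t$. Suppose that there exists a CNF contradiction $\phi$ over $\ell$ variables such that the lifted search problem $S_\phi\diamond\mathrm{eq}$ reduces to $\mathit{mKW}_g$ via an injective reduction and such that $t\ge 2\log\ell$. Then $$\log\mathsf{L}(U_m\diamond\mathit{mKW}_g)\;\ge\; m+\Omega(\mathit{NS}_{\mathbb{F}_2}(\phi)\cdot t).$$
   Context: All logarithms are base 2. Asymptotic convention: $A\ge B+\Omega(E)$ means that there are absolute constants $\kappa>0$ and $N_0$ such that $A\ge B+\kappa E$ whenever $E\ge N_0$. A communication problem $P\subseteq\mathcal{X}\times\mathcal{Y}\times\mathcal{O}$: Alice gets $x\in\mathcal{X}$, Bob gets $y\in\mathcal{Y}$, and they must output some $o$ with $(x,y,o)\in P$. In promise problems the protocol only needs to be correct on input pairs satisfying the promise. Protocols are deterministic binary protocol trees; $\mathsf{L}(P)$ is the minimal number of leaves of a protocol solving $P$. For a non-constant monotone $g:\{0,1\}^n\to\{0,1\}$, $\mathit{mKW}_g$ is the communication problem in which Alice gets $x\in g^{-1}(1)$, Bob gets $y\in g^{-1}(0)$, and they must find $i\in[n]$ with $x_i>y_i$. $U_m\diamond\mathit{mKW}_g$ (semi-monotone composition with the universal relation): Alice and Bob get matrices $X,Y\in\{0,1\}^{m\times n}$. Let $a,b\in\{0,1\}^m$ be obtained by applying $g$ to each row of $X$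 and $Y$ respectively. It is promised that $a\ne b$. The goal is to find an entry $(i,j)$ such that one of the following holds: ($a_i>b_i$ and $X_{i,j}>Y_{i,j}$); or ($a_i<b_i$ and $X_{i,j}<Y_{i,j}$); or ($a_i=b_i$ and $X_{i,j}\ne Y_{i,j}$). A CNF contradiction is an unsatisfiable CNF formula. $S_\phi$ is the search problem: given an assignment $z\in\{0,1\}^\ell$, find a clause of $\phi$ violated by $z$. With $\Lambda=\{0,1\}^t$, $S_\phi\diamond\mathrm{eq}$ is the communication problem on $\Lambda^\ell\times\Lambda^\ell$ whose solutions on $(x,y)$ are the solutions of $S_\phi$ on $(\mathrm{eq}(x_1,y_1),\dots,\mathrm{eq}(x_\ell,y_\ell))$. A reduction from $P\subseteq\mathcal{X}\times\mathcal{Y}\times\mathcal{O}$ to $P'\subseteq\mathcal{X}'\times\mathcal{Y}'\times\mathcal{O}'$ consists of functions $R_A:\mathcal{X}\to\mathcal{X}'$, $R_B:\mathcal{Y}\to\mathcal{Y}'$, $R_{\text{out}}:\mathcal{O}'\to\mathcal{O}$ such that for all $x,y,o'$: if $o'$ is a solution of $P'$ on $(R_A(x),R_B(y))$ then $R_{\text{out}}(o')$ is a solution of $P$ on $(x,y)$. It is injective if $R_A$ and $R_B$ are injective. Nullstellensatz degree: the polynomial encoding of a clause is the product of $1-x_i$ over its positive literals $x_i$ and of $x_i$ over its negative literals $\neg x_i$. Let $P_\phi=\{p_1,\dots,p_r\}$ consist of the encodings of all clauses of $\phi$ together with $x_i^2-x_i$ for $i\in[\ell]$, over $\mathbb{F}_2$.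 A refutation is a tuple of polynomials $q_1,\dots,q_r$ with $\sum_i p_iq_i=1$ syntactically; its degree is $\max_i\deg(p_iq_i)$. $\mathit{NS}_{\mathbb{F}_2}(\phi)$ is the minimum degree of a refutation. *)

(* Defs.v *)
From mathcomp Require Import all_boot all_order all_algebra.
From mathcomp Require Import boolp classical_sets reals constructive_ereal ereal exp.
(* The notations of [mpoly] clash with those of MathComp-Analysis. *)
From mathcomp Require Import -(notations) mpoly.

Set Implicit Arguments.
Unset Strict Implicit.
Unset Printing Implicit Defensive.

Import Order.TTheory GRing.Theory Num.Theory.
Local Open Scope ring_scope.

(* Minimum of a set of natural numbers; 0 if the set is empty. *)
Definition min_nat (S : set nat) : nat :=
  match pselect (exists k, `[< S k >]) with
  | left exS => ex_minn exS
  | right _ => 0%N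
  end.

Lemma min_natP (S : set nat) (k0 : nat) : S k0 ->
  S (min_nat S) /\ forall k, S k -> (min_nat S <= k)%N.
Proof.
move=> Sk0; rewrite /min_nat; case: pselect => [exS|[]]; last first.
  by exists k0; apply/asboolP.
case: ex_minnP => k /asboolP Sk min_k; split=> // j Sj.
by apply: min_k; apply/asboolP.
Qed.

Definition log2 (R : realType) (x : R) : R := ln x / ln 2.

(* log2 +oo = +oo *)
Definition elog2 (R : realType) (x : \bar R) : \bar R :=
  (lne x * ((ln 2)^-1)%:E)%E.

Definition bits (n : nat) := {ffun 'I_n -> bool}.

Definition monotone (n : nat) (g : bits n -> bool) : Prop :=
  forall x y : bits n, (forall i, x i ==> y i) -> g x ==> g y.

Definition non_constant (n : nat) (g : bits n -> bool) : Prop :=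
  exists x y : bits n, g x != g y.

Definition comm_problem (X Y O : Type) := X -> Y -> O -> Prop.

Definition promise (X Y : Type) := X -> Y -> Prop.

Inductive protocol (X Y O : Type) : Type :=
| Leaf of O
| AliceSpeaks of (X -> bool) & protocol X Y O & protocol X Y O
| BobSpeaks of (Y -> bool) & protocol X Y O & protocol X Y O.

Fixpoint leaves (X Y O : Type) (pi : protocol X Y O) : nat :=
  match pi with
  | Leaf _ => 1%N
  | AliceSpeaks _ pi0 pi1 => (leaves pi0 + leaves pi1)%N
  | BobSpeaks _ pi0 pi1 => (leaves pi0 + leaves pi1)%N
  end.

Fixpoint run (X Y O : Type) (pi : protocol X Y O) (x : X) (y : Y) : O :=
  match pi with
  | Leaf o => o
  | AliceSpeaks f pi0 pi1 => if f x then run pi1 x y else run pi0 x y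
  | BobSpeaks f pi0 pi1 => if f y then run pi1 x y else run pi0 x y
  end.

Definition solves (X Y O : Type) (pi : protocol X Y O)
    (D : promise X Y) (P : comm_problem X Y O) : Prop :=
  forall x y, D x y -> P x y (run pi x y).

(* The minimal number of leaves, as an extended real: the set below consists of
   natural numbers, so its infimum is attained unless no protocol solves the
   problem, in which case the value is +oo. *)
Definition leaf_complexity (R : realType) (X Y O : Type)
    (D : promise X Y) (P : comm_problem X Y O) : \bar R :=
  ereal_inf [set k | exists2 pi, solves pi D P & k = (leaves pi)%:R%:E]%classic.

Definition injective_reduction (X Y O X' Y' O' : Type)
    (P : comm_problem X Y O) (P' : comm_problem X' Y' O')
    (RA : X -> X') (RB : Y -> Y') (Rout : O' -> O) : Prop :=
  [/\ forall x y o', P' (RA x) (RB y) o' -> P x y (Rout o'),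
      injective RA & injective RB].

Definition injectively_reduces (X Y O X' Y' O' : Type)
    (P : comm_problem X Y O) (P' : comm_problem X' Y' O') : Prop :=
  exists RA RB Rout, injective_reduction P P' RA RB Rout.

Definition mKW (n : nat) (g : bits n -> bool) :
    comm_problem {x : bits n | g x} {y : bits n | ~~ g y} 'I_n :=
  fun x y i => (val x i = true) /\ (val y i = false).

Arguments mKW {n} g.

Definition apply_rows (m n : nat) (g : bits n -> bool) (X : 'M[bool]_(m, n)) :
    bits m :=
  [ffun i => g [ffun j => X i j]].

Definition U_mKW_promise (m n : nat) (g : bits n -> bool) :
    promise 'M[bool]_(m, n) 'M[bool]_(m, n) :=
  fun X Y => apply_rows g X <> apply_rows g Y.

(* For bits [u] and [v], [u > v] reads [u && ~~ v]. *)
Definition U_mKW (m n : nat) (g : bits n -> bool) :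
    comm_problem 'M[bool]_(m, n) 'M[bool]_(m, n) ('I_m * 'I_n) :=
  fun X Y ij =>
    let: (i, j) := ij in
    let a := apply_rows g X in
    let b := apply_rows g Y in
    [\/ (a i && ~~ b i) && (X i j && ~~ Y i j),
        (~~ a i && b i) && (~~ X i j && Y i j) |
        (a i == b i) && (X i j != Y i j)].

Arguments U_mKW_promise m {n} g.
Arguments U_mKW m {n} g.

(* [(i, true)] is the literal x_i and [(i, false)] its negation. *)
Definition literal (l : nat) := ('I_l * bool)%type.

(* A disjunction of literals. *)
Definition clause (l : nat) := {set literal l}.

(* A conjunction of clauses. *)
Definition cnf (l : nat) := {set clause l}.

Definition violated (l : nat) (z : bits l) (C : clause l) : bool :=
  [forall L in C, z L.1 != L.2].

Definition satisfies (l : nat) (z : bits l) (phi : cnf l) : bool :=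
  [forall C in phi, ~~ violated z C].

Definition contradiction (l : nat) (phi : cnf l) : Prop :=
  forall z : bits l, ~~ satisfies z phi.

Definition search_problem (l : nat) (phi : cnf l) (z : bits l) (C : clause l) : Prop :=
  C \in phi /\ violated z C.

Definition lifted_search (Lambda O : Type) (l : nat) (S : bits l -> O -> Prop)
    (gd : Lambda -> Lambda -> bool) :
    comm_problem {ffun 'I_l -> Lambda} {ffun 'I_l -> Lambda} O :=
  fun x y o => S [ffun i => gd (x i) (y i)] o.

Definition eq_gadget (t : nat) (u v : bits t) : bool := u == v.
Arguments eq_gadget t : clear implicits.

Definition F2poly (l : nat) := mpoly l 'F_2.

Definition var (l : nat) (i : 'I_l) : F2poly l := mpolyX 'F_2 (mnm1 i).

(* Total degree, with degree 0 for the zero polynomial. *)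
Definition degree (l : nat) (p : F2poly l) : nat := (mmeasure mdeg p).-1.

Definition clause_poly (l : nat) (C : clause l) : F2poly l :=
  \prod_(L in C) (if L.2 then 1 - var L.1 else var L.1).

Definition NS_axioms (l : nat) (phi : cnf l) : seq (F2poly l) :=
  [seq clause_poly C | C <- enum phi] ++
  [seq var i ^+ 2 - var i | i <- enum 'I_l].

Definition NS_refutation (l : nat) (phi : cnf l)
    (q : (size (NS_axioms phi)).-tuple (F2poly l)) : Prop :=
  \sum_(k < size (NS_axioms phi)) (NS_axioms phi)`_k * tnth q k = 1.

Definition NS_refutation_degree (l : nat) (phi : cnf l)
    (q : (size (NS_axioms phi)).-tuple (F2poly l)) : nat :=
  \max_(k < size (NS_axioms phi)) degree ((NS_axioms phi)`_k * tnth q k)%R.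

(* The set of degrees is nonempty for every contradiction. *)
Definition NS (l : nat) (phi : cnf l) : nat :=
  min_nat [set d | exists2 q, @NS_refutation l phi q
                            & d = NS_refutation_degree q]%classic.

(* Main.v *)
(* Over F_2, a linear functional witnessing that phi has no Nullstellensatz
   refutation of degree < d := NS phi is summation against a function
   p : {0,1}^l -> F_2 with total sum 1, and on the assignments violating a clause
   p coincides with a polynomial of degree at most l - d.  Let
   A(x, y) = p(eq(x_1, y_1), ..., eq(x_l, y_l)), a matrix of order D = 2^(t l).
   Since 2^t is even, A is a symmetric involution, and the degree bound makes the
   rank of A on every rectangle that is monochromatic for S_phi o eq at most
   D (l / 2^t)^d <= D 2^(-td/2).

   Index the inputs of U_m o mKW_g by sequences of m pairs (a_i, x_i), the i-th row
   being R_A(x_i) if a_i = 1 and R_B(x_i) if a_i = 0.  The block matrix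
   N = [[I, A], [A, I]] has rank only D because A^2 = I, so its m-th tensor power
   has rank at most D^m, whereas the identity matrix of the same order has rank
   2^m D^m; hence M := N^(tensor m) - I has rank at least (2^m - 1) D^m.  The matrix
   M vanishes when a = b, as well as when a_i = b_i and X_i, Y_i differ; on a leaf it
   is therefore supported where a_i <> b_i and the i-th tensor factor is a
   monochromatic part of A, so its rank there is at most 2 D^m 2^(-td/2).
   Subadditivity of the rank bounds the number of leaves from below. *)

Require Import Defs.
From mathcomp Require Import all_boot all_order all_algebra.
From mathcomp Require Import boolp classical_sets reals constructive_ereal ereal exp.
From mathcomp Require Import -(notations) mpoly.
From mathcomp Require Import sequences ring lra zify.

Set Implicit Arguments.
Unset Strict Implicit.
Unset Printing Implicit Defensive.

Import Order.TTheory GRing.Theory Num.Theory.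
Local Open Scope ring_scope.

(** * Rank of functions of two arguments *)

(** Rank as the length of a factorization, without matrices: restricting to a rectangle is scaling
    by indicators, and a tensor product is a pointwise product of functions of separate
    coordinates. *)
Definition rank_le (F : fieldType) (X Y : Type) (r : nat) (f : X -> Y -> F) : Prop :=
  exists (u : X -> 'I_r -> F) (v : 'I_r -> Y -> F),
    forall x y, f x y = \sum_k u x k * v k y.

Lemma rank_le_in (F : fieldType) (X Y : Type) (K : finType) (A : {pred K})
    (f : X -> Y -> F) (u : X -> K -> F) (v : K -> Y -> F) :
  (forall x y, f x y = \sum_(k in A) u x k * v k y) -> rank_le #|A| f.
Proof.
move=> fE; exists (fun x k => u x (enum_val k)), (fun k y => v (enum_val k) y).
by move=> x y; rewrite fE big_enum_val.
Qed.

Lemma rank_le_fin (F : fieldType) (X Y : Type) (K : finType)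
    (f : X -> Y -> F) (u : X -> K -> F) (v : K -> Y -> F) :
  (forall x y, f x y = \sum_k u x k * v k y) -> rank_le #|K| f.
Proof. by move=> fE; apply: (rank_le_in (u := u) (v := v)). Qed.

Lemma rank_le_ext (F : fieldType) (X Y : Type) r (f g : X -> Y -> F) :
  f =2 g -> rank_le r f -> rank_le r g.
Proof. by move=> fg [u [v fE]]; exists u, v => x y; rewrite -fg. Qed.

Lemma rank_le_comp (F : fieldType) (X Y X' Y' : Type) r (f : X -> Y -> F)
    (h : X' -> X) (k : Y' -> Y) :
  rank_le r f -> rank_le r (fun x y => f (h x) (k y)).
Proof. by move=> [u [v fE]]; exists (u \o h), (fun j => v j \o k) => x y; rewrite fE. Qed.

Lemma rank_le_scale (F : fieldType) (X Y : Type) r (f : X -> Y -> F)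
    (a : X -> F) (b : Y -> F) :
  rank_le r f -> rank_le r (fun x y => a x * f x y * b y).
Proof.
move=> [u [v fE]]; exists (fun x k => a x * u x k), (fun k y => v k y * b y) => x y.
by rewrite fE mulr_sumr mulr_suml; apply: eq_bigr => k _; rewrite !mulrA.
Qed.

Lemma rank_le0 (F : fieldType) (X Y : Type) r : rank_le r (fun (_ : X) (_ : Y) => 0 : F).
Proof.
by exists (fun _ _ => 0), (fun _ _ => 0) => x y; rewrite big1 // => k _; rewrite mul0r.
Qed.

Lemma rank_leD (F : fieldType) (X Y : Type) r s (f g : X -> Y -> F) :
  rank_le r f -> rank_le s g -> rank_le (r + s) (fun x y => f x y + g x y).
Proof.
move=> [u [v fE]] [u' [v' gE]].
rewrite -[r in (r + s)%N]card_ord -[s in (_ + s)%N]card_ord -card_sum.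
apply: (@rank_le_fin _ _ _ _ _
  (fun x k => match k with inl i => u x i | inr i => u' x i end)
  (fun k y => match k with inl i => v i y | inr i => v' i y end)) => x y.
by rewrite big_sumType /= fE gE.
Qed.

Lemma rank_leM (F : fieldType) (X Y : Type) r s (f g : X -> Y -> F) :
  rank_le r f -> rank_le s g -> rank_le (r * s) (fun x y => f x y * g x y).
Proof.
move=> [u [v fE]] [u' [v' gE]].
rewrite -[r in (r * s)%N]card_ord -[s in (_ * s)%N]card_ord -card_prod.
apply: (@rank_le_fin _ _ _ _ _
  (fun x k => u x k.1 * u' x k.2) (fun k y => v k.1 y * v' k.2 y)) => x y.
rewrite fE gE big_distrlr pair_big /=; apply: eq_bigr => k _.
by rewrite mulrACA.
Qed.

Lemma rank_le_prod (F : fieldType) (X Y : Type) (I : finType) (P : pred I) (r : I -> nat)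
    (f : I -> X -> Y -> F) :
  (forall i, P i -> rank_le (r i) (f i)) ->
  rank_le (\prod_(i | P i) r i) (fun x y => \prod_(i | P i) f i x y).
Proof.
move=> rf; pose g s := fun x y => \prod_(i <- s | P i) f i x y.
rewrite -/(g (index_enum I)); elim: (index_enum I) => [|i s IHs].
  rewrite big_nil; exists (fun _ _ => 1), (fun _ _ => 1) => x y.
  by rewrite /g big_nil big_ord1 mulr1.
rewrite big_cons; case: ifP => Pi.
  apply: rank_le_ext (rank_leM (rf i Pi) IHs) => x y.
  by rewrite /g big_cons Pi.
by apply: rank_le_ext IHs => x y; rewrite /g big_cons Pi.
Qed.

Lemma rank_le_sum (F : fieldType) (X Y : Type) (I : finType) (P : pred I) (r : I -> nat)
    (f : I -> X -> Y -> F) :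
  (forall i, P i -> rank_le (r i) (f i)) ->
  rank_le (\sum_(i | P i) r i) (fun x y => \sum_(i | P i) f i x y).
Proof.
move=> rf; pose g s := fun x y => \sum_(i <- s | P i) f i x y.
rewrite -/(g (index_enum I)); elim: (index_enum I) => [|i s IHs].
  by apply: rank_le_ext (rank_le0 _ _ _ _) => x y; rewrite /g big_nil.
rewrite big_cons; case: ifP => Pi.
  apply: rank_le_ext (rank_leD (rf i Pi) IHs) => x y.
  by rewrite /g big_cons Pi.
by apply: rank_le_ext IHs => x y; rewrite /g big_cons Pi.
Qed.

(** There are at most [#|A|] distinct rows, and the left factor selects the one named by [h x]. *)
Lemma rank_le_codom (F : fieldType) (X Y : Type) (K : finType) (A : {pred K})
    (h : X -> K) (f : K -> Y -> F) :
  (forall x, h x \in A) -> rank_le #|A| (fun x y => f (h x) y).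
Proof.
move=> hA; apply: (@rank_le_in _ _ _ _ _ _ (fun x k => (h x == k)%:R) f) => x y.
rewrite (bigD1 (h x)) //= eqxx mul1r big1 ?addr0 // => k /andP[_ /negPf].
by rewrite eq_sym => ->; rewrite mul0r.
Qed.

Lemma rank_le_delta (F : fieldType) (X : finType) r :
  rank_le r (fun x y : X => (x == y)%:R : F) -> (#|X| <= r)%N.
Proof.
move=> [u [v fE]].
pose U : 'M[F]_(#|X|, r) := \matrix_(i, k) u (enum_val i) k.
pose V : 'M[F]_(r, #|X|) := \matrix_(k, j) v k (enum_val j).
have UV : U *m V = 1%:M.
  apply/matrixP => i j; rewrite !mxE -(inj_eq enum_val_inj) fE.
  by apply: eq_bigr => k _; rewrite !mxE.
have := leq_trans (mxrankM_maxl U V) (rank_leq_col U).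
by rewrite UV mxrank1.
Qed.

(** Each message cuts the current rectangle in two, and the ranks of the two parts add up. The
    rectangle given by [P] and [Q] is arbitrary because the induction shrinks it; [a] and [b] let
    the matrix have index sets other than the inputs of the protocol. *)
Lemma rank_le_leaves (F : fieldType) (X Y X' Y' O : Type) (s : nat) (f : X' -> Y' -> F)
    (pi : protocol X Y O) (a : X' -> X) (b : Y' -> Y) (P : pred X') (Q : pred Y') :
  (forall (P' : pred X') (Q' : pred Y') (o : O),
     (forall x y, P' x -> Q' y -> [/\ P x, Q y & run pi (a x) (b y) = o]) ->
     rank_le s (fun x y => (P' x)%:R * f x y * (Q' y)%:R)) ->
  rank_le (s * leaves pi) (fun x y => (P x)%:R * f x y * (Q y)%:R).
Proof.
elim: pi P Q => [o|h pi0 IH0 pi1 IH1|h pi0 IH0 pi1 IH1] P Q H /=.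
- by rewrite muln1; apply: (H _ _ o).
- rewrite mulnDr.
  have r0 : rank_le (s * leaves pi0) (fun x y => (P x && ~~ h (a x))%:R * f x y * (Q y)%:R).
    apply: (IH0 [pred x | P x && ~~ h (a x)]) => P' Q' o PQ; apply: (H _ _ o) => x y Px Qy.
    by have [/andP[Px0 /negPf h0] Qy0 <-] := PQ x y Px Qy; rewrite /= h0.
  have r1 : rank_le (s * leaves pi1) (fun x y => (P x && h (a x))%:R * f x y * (Q y)%:R).
    apply: (IH1 [pred x | P x && h (a x)]) => P' Q' o PQ; apply: (H _ _ o) => x y Px Qy.
    by have [/andP[Px0 h1] Qy0 <-] := PQ x y Px Qy; rewrite /= h1.
  apply: rank_le_ext (rank_leD r0 r1) => x y.
  by case: (P x) (h (a x)) => [] []; rewrite ?mul0r ?addr0 ?add0r.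
- rewrite mulnDr.
  have r0 : rank_le (s * leaves pi0) (fun x y => (P x)%:R * f x y * (Q y && ~~ h (b y))%:R).
    apply: (IH0 _ [pred y | Q y && ~~ h (b y)]) => P' Q' o PQ; apply: (H _ _ o) => x y Px Qy.
    by have [Px0 /andP[Qy0 /negPf h0] <-] := PQ x y Px Qy; rewrite /= h0.
  have r1 : rank_le (s * leaves pi1) (fun x y => (P x)%:R * f x y * (Q y && h (b y))%:R).
    apply: (IH1 _ [pred y | Q y && h (b y)]) => P' Q' o PQ; apply: (H _ _ o) => x y Px Qy.
    by have [Px0 /andP[Qy0 h1] <-] := PQ x y Px Qy; rewrite /= h1.
  apply: rank_le_ext (rank_leD r0 r1) => x y.
  by case: (Q y) (h (b y)) => [] []; rewrite ?mulr0 ?addr0 ?add0r.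
Qed.

(** * Lifting functions on the cube by equality *)

Lemma F2_mulrr (a : 'F_2) : a * a = a.
Proof. by case: a => [[|[|]]] //= ?; apply/val_inj. Qed.

Lemma F2_addrr (a : 'F_2) : a + a = 0.
Proof. by case: a => [[|[|]]] //= ?; apply/val_inj. Qed.

Lemma subset_extend (T : finType) (S : {set T}) k :
  (#|S| <= k <= #|T|)%N -> exists2 S' : {set T}, S \subset S' & #|S'| = k.
Proof.
move=> /andP[Sk kT]; exists (S :|: [set:: take (k - #|S|) (enum (~: S))]).
  exact: finset.subsetUl.
set B := [set:: _]; have BS : B \subset ~: S.
  by apply/fintype.subsetP => x; rewrite inE => /mem_take; rewrite mem_enum.
have -> : #|S :|: B| = (#|S| + #|B|)%N.
  by apply/eqP; rewrite (leq_card_setU S B).2 disjoint_sym finset.disjoints_subset.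
rewrite cardsE (card_uniqP _) ?take_uniq ?enum_uniq // size_takel ?subnKC //.
by rewrite -cardE [#|~: S|]cardsCs finset.setCK leq_sub2r.
Qed.

(* Every monomial in the indicators [x i == y i] of degree at most [k] depends
   only on the coordinates of [x] in a fixed set of size [k] containing its
   support. *)
Lemma rank_le_low_degree (F : fieldType) (L : finType) (x0 : L) l k
    (c : {set 'I_l} -> F) :
  (forall S : {set 'I_l}, (k < #|S|)%N -> c S = 0) -> (k <= l)%N ->
  rank_le ('C(l, k) * #|L| ^ k)
    (fun x y : {ffun 'I_l -> L} => \sum_S c S * \prod_(i in S) (x i == y i)%:R).
Proof.
move=> c0 kl.
have extend (S : {set 'I_l}) : exists T : {set 'I_l},
    (#|S| <= k)%N ==> (S \subset T) && (#|T| == k).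
  have [Sk|_] := leqP #|S| k; last by exists S.
  have [|T ST Tk] := @subset_extend _ S k; first by rewrite Sk card_ord.
  by exists T; rewrite ST Tk eqxx.
pose tau S := xchoose (extend S); have tauP S := implyP (xchooseP (extend S)).
pose restr (T : {set 'I_l}) (x : {ffun 'I_l -> L}) := [ffun i => if i \in T then x i else x0].
have rT (T : {set 'I_l}) : #|T| == k -> rank_le (#|L| ^ k) (fun x y : {ffun 'I_l -> L} =>
    \sum_(S : {set 'I_l} | (#|S| <= k)%N && (tau S == T))
       c S * \prod_(i in S) (x i == y i)%:R).
  (* Freezing the coordinates outside [T] at [x0] leaves [#|L| ^ k] possible rows; the number of
     sets [T] gives the binomial factor. *)
  move=> /eqP Tk; pose A := pffun_on x0 T (@predT L).
  have xA x : restr T x \in A.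
    apply/pffun_onP; split=> //; apply/fintype.subsetP => i; rewrite inE ffunE.
    by case: (i \in T); rewrite ?eqxx.
  have := @rank_le_codom F _ {ffun 'I_l -> L} _ A (restr T) (fun x y =>
    \sum_(S : {set 'I_l} | (#|S| <= k)%N && (tau S == T))
       c S * \prod_(i in S) (x i == y i)%:R) xA.
  rewrite card_pffun_on Tk; apply: rank_le_ext => x y.
  apply: eq_bigr => S /andP[Sk /eqP tS]; congr (_ * _); apply: eq_bigr => i iS.
  have /andP[/fintype.subsetP ST _] := tauP S Sk.
  by rewrite ffunE -tS (ST _ iS).
have := rank_le_sum rT; rewrite sum_nat_const -[#|_|]cardsE card_draws card_ord.
apply: rank_le_ext => x y.
rewrite [RHS](bigID (fun S : {set 'I_l} => (#|S| <= k)%N)) /=.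
rewrite [X in _ + X]big1 ?addr0; last first.
  by move=> S; rewrite -ltnNge => /c0 ->; rewrite mul0r.
rewrite [RHS](partition_big tau (fun T : {set 'I_l} => #|T| == k)) //= => S Sk.
by have /andP[_ ->] := tauP S Sk.
Qed.

Definition lift_eq (F : Type) (L : finType) l (p : bits l -> F) (x y : {ffun 'I_l -> L}) : F :=
  p [ffun i => x i == y i].

Lemma lift_eqC (F : Type) (L : finType) l (p : bits l -> F) (x y : {ffun 'I_l -> L}) :
  lift_eq p x y = lift_eq p y x.
Proof. by congr p; apply/ffunP => i; rewrite !ffunE eq_sym. Qed.

Lemma F2_natr n : n%:R = (odd n)%:R :> 'F_2.
Proof.
by elim: n => // n IHn; rewrite -natr1 IHn /=; case: odd; rewrite /= ?F2_addrr ?add0r.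
Qed.

Lemma prod_delta (F : comNzRingType) (I : finType) (T : eqType) (f g : {ffun I -> T}) :
  \prod_i (f i == g i)%:R = (f == g)%:R :> F.
Proof.
have [->|/eqP fg] := eqVneq f g; first by rewrite big1 // => i _; rewrite eqxx.
have /existsP[i /negPf fgi] : [exists i, f i != g i].
  by apply: contra_notT fg => /existsPn fg0; apply/ffunP => i; apply/eqP/negbNE/fg0.
by rewrite (bigD1 i) //= fgi mul0r.
Qed.

Lemma sum_delta (F : comNzRingType) (I : finType) (f : I -> F) j :
  \sum_i f i * (j == i)%:R = f j.
Proof.
rewrite (bigD1 j) //= eqxx mulr1 big1 ?addr0 // => i /negPf.
by rewrite eq_sym => ->; rewrite mulr0.
Qed.

(** For fixed [x], the number of [z] with equality pattern [u] is a power of [#|L| - 1], hence odd,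
    so each [p u] survives exactly once modulo 2. *)
Lemma lift_eq_row_sum (L : finType) l (p : bits l -> 'F_2) (x : {ffun 'I_l -> L}) :
  ~~ odd #|L| -> \sum_z lift_eq p x z = \sum_u p u.
Proof.
move=> evenL.
have card1 (u : bits l) :
    \sum_(z : {ffun 'I_l -> L}) \prod_i ((x i == z i) == u i)%:R = 1 :> 'F_2.
  rewrite -(bigA_distr_bigA (fun i v => ((x i == v) == u i)%:R)) big1 // => i _.
  case: (u i); rewrite (bigD1 (x i)) //= eqxx /=.
    by rewrite big1 ?addr0 // => v /negPf; rewrite eq_sym => ->.
  rewrite add0r (eq_bigr (fun=> 1)); last by move=> v /negPf; rewrite eq_sym => ->.
  rewrite sumr_const cardC1 F2_natr; move: evenL.
  have : (0 < #|L|)%N by apply/card_gt0P; exists (x i).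
  by case: #|L| => // N _ /=; case: odd.
transitivity (\sum_(z : {ffun 'I_l -> L}) \sum_u p u * \prod_i ((x i == z i) == u i)%:R).
  apply: eq_bigr => z _; rewrite /lift_eq -[LHS]sum_delta; apply: eq_bigr => u _.
  by rewrite -prod_delta; congr (_ * _); apply: eq_bigr => i _; rewrite ffunE.
rewrite exchange_big; apply: eq_bigr => u _.
by rewrite -mulr_sumr card1 mulr1.
Qed.

(* Off the diagonal, the terms cancel in pairs under [z |-> z + x + y], which
   exchanges the roles of [x] and [y]. *)
Lemma lift_eq_involutive l t (p : bits l -> 'F_2) (x y : {ffun 'I_l -> bits t}) :
  (0 < t)%N -> \sum_u p u = 1 ->
  \sum_z lift_eq p x z * lift_eq p z y = (x == y)%:R.
Proof.
move=> t_gt0 p1; have [->|/eqP xy] := eqVneq x y.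
  under eq_bigr => z _ do rewrite [X in _ * X]lift_eqC F2_mulrr.
  by rewrite lift_eq_row_sum // card_ffun card_bool card_ord oddX negb_or -lt0n t_gt0.
have [i /existsP[j xyij]] : exists i, [exists j, x i j != y i j].
  apply/existsP; apply: contra_notT xy => /existsPn xy0; apply/ffunP => i; apply/ffunP => j.
  by apply/eqP/negbNE; have /existsPn := xy0 i; apply.
pose flip (z : {ffun 'I_l -> bits t}) : {ffun 'I_l -> bits t} :=
  [ffun a => [ffun b => z a b (+) (x a b (+) y a b)]].
have flipK : involutive flip.
  by move=> z; apply/ffunP => a; apply/ffunP => b; rewrite !ffunE addbK.
have flipx z : lift_eq p x (flip z) = lift_eq p z y.
  congr p; apply/ffunP => a; rewrite !ffunE.
  apply/eqP/eqP => [|za]; first move/ffunP => xz; apply/ffunP => b.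
    by have := xz b; rewrite !ffunE; case: (x a b) (y a b) (z a b) => [] [] [].
  by rewrite !ffunE za; case: (x a b) (y a b) => [] [].
have flipy z : lift_eq p (flip z) y = lift_eq p x z.
  by rewrite -[in RHS](flipK z) flipx.
(* Since [x] and [y] differ at the bit [(i, j)], [flip] toggles this bit of [z] and so maps one half
   of the sum onto the other; equal halves cancel in characteristic 2. *)
rewrite (bigID (fun z : {ffun 'I_l -> bits t} => z i j)) /=.
rewrite [X in _ + X](reindex_inj (inv_inj flipK)) /=.
rewrite [X in _ + X](eq_big (fun z : {ffun 'I_l -> bits t} => z i j)
  (fun z => lift_eq p x z * lift_eq p z y)) ?F2_addrr // => z.
  by rewrite !ffunE; move: xyij; case: (x i j) (y i j) (z i j) => [] [] [].
by rewrite flipx flipy mulrC.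
Qed.

(** The right-hand side is the term of [S] when a product of sums is expanded over subsets; the
    value 0 off [A] kills every [S] not contained in [A]. *)
Lemma prod_subset (F : comNzRingType) (I : finType) (A S : {set I}) (a b : I -> F) :
  (S \subset A)%:R * (\prod_(i in A :\: S) a i * \prod_(i in S) b i) =
  \prod_i (if i \in S then if i \in A then b i else 0
           else if i \in A then a i else 1).
Proof.
have [SA|/fintype.subsetPn[i iS /negPf iA]] := boolP (S \subset A); last first.
  by rewrite mul0r (bigD1 i) //= iS iA mul0r.
rewrite mul1r [RHS](bigID (mem S)) /= mulrC; congr (_ * _).
  by apply: eq_bigr => i iS; rewrite iS (fintype.subsetP SA).
rewrite [RHS](bigID (mem A)) /= [X in _ * X]big1 ?mulr1; last first.
  by move=> i /andP[/negPf -> /negPf ->].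
by apply: eq_big => i; rewrite ?inE // => /andP[/negPf -> ->].
Qed.

Lemma violated_val l (z : bits l) (C : clause l) (L : literal l) :
  violated z C -> L \in C -> L.2 = ~~ z L.1.
Proof. by move=> /forall_inP zC /zC; case: (z L.1) L.2 => [] []. Qed.

Definition clause_free l (C : clause l) : {set 'I_l} := ~: [set L.1 | L in C].

(** A violated clause cannot contain a variable together with its negation, so its literals have
    distinct variables. *)
Lemma card_clause_free l (z : bits l) (C : clause l) :
  violated z C -> (#|C| + #|clause_free C|)%N = l.
Proof.
move=> zC; have inj : {in C &, injective (fun L : literal l => L.1)}.
  move=> [i a] [j b] iC jC /= ij; rewrite -ij.
  by have /= -> := violated_val zC iC; have /= -> := violated_val zC jC; rewrite ij.
rewrite [#|clause_free C|]cardsCs finset.setCK card_ord (card_in_imset inj) subnKC //.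
by rewrite -[l in (_ <= l)%N]card_ord -(card_in_imset inj) max_card.
Qed.

(* The factor [z i + (1 - u i)] indicates [z i = u i] over F_2; only the
   coordinates that the violation of [C] leaves free need it. *)
Lemma violated_expansion l (p : bits l -> 'F_2) (C : clause l) (z : bits l) :
  violated z C ->
  p z = \sum_(S : {set 'I_l}) ((S \subset clause_free C)%:R *
      \sum_u p u * (violated u C)%:R * \prod_(i in clause_free C :\: S) (1 - (u i)%:R))
     * \prod_(i in S) (z i)%:R.
Proof.
set A := clause_free C => zC.
transitivity (\sum_u p u * (violated u C)%:R * \prod_i
    ((if i \in A then (z i)%:R else 0) + (if i \in A then 1 - (u i)%:R else 1) : 'F_2)).
  rewrite -[LHS]sum_delta; apply: eq_bigr => u _; rewrite -mulrA; congr (_ * _).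
  have [uC|uC] := boolP (violated u C); last first.
    by rewrite mul0r; case: eqP uC zC => // <- /negPf ->.
  rewrite mul1r -prod_delta; apply: eq_bigr => i _.
  have [iA|] := boolP (i \in A); first by case: (z i) (u i) => [] []; apply/val_inj.
  rewrite inE negbK => /imsetP[L LC ->]; rewrite add0r.
  have := violated_val zC LC; rewrite (violated_val uC LC) => /negb_inj ->.
  by rewrite eqxx.
under eq_bigr => u _ do rewrite bigA_distr mulr_sumr.
rewrite exchange_big; apply: eq_bigr => S _.
rewrite mulr_sumr mulr_suml; apply: eq_bigr => u _.
by rewrite -prod_subset; ring.
Qed.

(** * Duality for Nullstellensatz degree *)

(** A vector outside the row space of a matrix is not annihilated by the cokernel. A cokernel column
    on which [v] does not vanish, normalized, is the separating [p]. *)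
Lemma fredholm (F : fieldType) (I B : finType) (g : I -> B -> F) (v : B -> F) :
  (exists a : I -> F, forall u, v u = \sum_i a i * g i u) \/
  (exists2 p : B -> F, \sum_u v u * p u = 1 & forall i, \sum_u g i u * p u = 0).
Proof.
pose G : 'M[F]_(#|I|, #|B|) := \matrix_(i, j) g (enum_val i) (enum_val j).
pose V : 'rV[F]_#|B| := \row_j v (enum_val j).
have GE i u : G (enum_rank i) (enum_rank u) = g i u by rewrite mxE !enum_rankK.
have VE u : V 0 (enum_rank u) = v u by rewrite mxE enum_rankK.
have [/submxP[D VD]|] := boolP (V <= G)%MS; [left|move=> VG; right].
 exists (fun i => D 0 (enum_rank i)) => u.
  rewrite -VE VD mxE (reindex (@enum_rank I)) /=; last exact/onW_bij/enum_rank_bij.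
  by apply: eq_bigr => i _; rewrite GE.
move: VG; rewrite submxE => /rV0Pn[k wk]; set K := cokermx G in wk.
exists (fun u => K (enum_rank u) k / (V *m K) 0 k) => [|i].
  apply: (mulIf wk); rewrite mul1r mulr_suml [RHS]mxE (reindex (@enum_rank B)) /=; last first.
    exact/onW_bij/enum_rank_bij.
  by apply: eq_bigr => u _; rewrite -mulrA divfK // VE.
apply: (mulIf wk); rewrite mul0r mulr_suml.
transitivity ((G *m K) (enum_rank i) k); last by rewrite mulmx_coker mxE.
rewrite [RHS]mxE [RHS](reindex (@enum_rank B)) /=; last exact/onW_bij/enum_rank_bij.
by apply: eq_bigr => u _; rewrite -mulrA divfK // GE.
Qed.

(** [mmeasure mdeg] is the degree plus one, and 0 for the zero polynomial, so the bound [d] means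
    degree below [d]. Replacing a square of a variable by the variable lowers the degree of a
    monomial, so all multiples of Boolean axioms stay within the bound. *)
Lemma boolean_reduction l d (h : F2poly l) : (mmeasure mdeg h <= d)%N ->
  exists (a : {set 'I_l} -> 'F_2) (r : 'I_l -> F2poly l),
    (forall i, (mmeasure mdeg ((var i ^+ 2 - var i) * r i)%R <= d)%N) /\
    h = \sum_(S : {set 'I_l}) a S *: \prod_(i in S) var i
        + \sum_i (var i ^+ 2 - var i) * r i.
Proof.
pose red (h : F2poly l) := exists (a : {set 'I_l} -> 'F_2) (r : 'I_l -> F2poly l),
    (forall i, (mmeasure mdeg ((var i ^+ 2 - var i) * r i)%R <= d)%N) /\
    h = \sum_(S : {set 'I_l}) a S *: \prod_(i in S) var i
        + \sum_i (var i ^+ 2 - var i) * r i.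
have red0 : red 0.
  exists (fun=> 0), (fun=> 0); split=> [i|]; first by rewrite mulr0 mmeasure0.
  by rewrite !big1 ?addr0 // => ? _; rewrite ?scale0r ?mulr0.
have redD h1 h2 : red h1 -> red h2 -> red (h1 + h2).
  move=> [a1 [r1 [d1 ->]]] [a2 [r2 [d2 ->]]].
  exists (fun S => a1 S + a2 S), (fun i => r1 i + r2 i); split=> [i|].
    by rewrite mulrDr (leq_trans (mmeasureD_le _ _ _)) // geq_max d1 d2.
  rewrite addrACA -!big_split /=; congr (_ + _); apply: eq_bigr => ? _.
    by rewrite scalerDl.
  by rewrite mulrDr.
have redZ c h1 : red h1 -> red (c *: h1).
  move=> [a1 [r1 [d1 ->]]].
  exists (fun S => c * a1 S), (fun i => c *: r1 i); split=> [i|].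
    by rewrite -scalerAr (leq_trans (mmeasureZ_le _ _ _)).
  rewrite scalerDr !scaler_sumr; congr (_ + _); apply: eq_bigr => ? _.
    by rewrite scalerA.
  by rewrite scalerAr.
have redX n : forall m : multinom l, (mdeg m < n)%N -> (mdeg m < d)%N -> red (mpolyX 'F_2 m).
  elim: n => [|n IHn] m // mn md.
  have [/existsP[i mi]|/existsPn m1] := boolP [exists i, 1 < m i]%N.
    pose m2 := mnm_muln (mnm1 i) 2; pose m' := mnm_sub m m2.
    have m2m : mnm_add m' m2 = m.
      apply/submK/mnm_lepP => j; rewrite mulmnE mnm1E.
      by case: eqP => // <-; rewrite mul1n.
    pose m'' := mnm_add m' (mnm1 i).
    have dm : mdeg m = (mdeg m'').+1.
      by rewrite -[in LHS]m2m /m2 /m'' !mdegD !mdeg1; lia.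
    have Xm : mpolyX 'F_2 m = (var i ^+ 2 - var i) * mpolyX 'F_2 m' + mpolyX 'F_2 m''.
      by rewrite -[in LHS]m2m !mpolyXD /var; ring.
    rewrite Xm; apply: redD; last first.
      by apply: IHn; [rewrite -dm | rewrite (leq_trans _ (ltnW md)) ?dm].
    exists (fun=> 0), (fun j => if j == i then mpolyX 'F_2 m' else 0); split=> [j|].
      case: eqP => [->|_]; last by rewrite mulr0 mmeasure0.
      have -> : (var i ^+ 2 - var i) * mpolyX 'F_2 m' = mpolyX 'F_2 m - mpolyX 'F_2 m''.
        by rewrite Xm addrK.
      rewrite (leq_trans (mmeasureD_le _ _ _)) // mmeasureN !mmeasureX geq_max md -dm ltnW //.
    rewrite big1 ?add0r => [|S _]; last by rewrite scale0r.
    by rewrite (bigD1 i) //= eqxx big1 ?addr0 // => j /negPf ->; rewrite mulr0.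
  exists (fun S => (S == [set i | m i == 1%N])%:R), (fun=> 0); split=> [i|].
    by rewrite mulr0 mmeasure0.
  rewrite [X in _ + X]big1 ?addr0 => [|i _]; last by rewrite mulr0.
  rewrite (bigD1 [set i | m i == 1%N]) //= eqxx scale1r [X in _ + X]big1 ?addr0; last first.
    by move=> S /negPf ->; rewrite scale0r.
  rewrite mpolyXE_id [RHS]big_mkcond; apply: eq_bigr => i _; rewrite inE.
  by have := m1 i; case: (m i) => [|[|k]].
move=> hd; rewrite -/(red _) [h]mpolyE big_seq; apply: big_ind => // m mh.
by apply/redZ/(redX (mdeg m).+1) => //; apply: leq_trans hd; apply: mmeasure_mnm_lt.
Qed.

(** At the indicator of [S] only the subsets of [S] contribute, and the proper ones have zero
    coefficients by induction on the size. *)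
Lemma multilinear_eq0 l (a : {set 'I_l} -> 'F_2) :
  (forall z : bits l, \sum_(S : {set 'I_l}) a S * \prod_(i in S) (z i)%:R = 0) ->
  forall S, a S = 0.
Proof.
move=> a0 S; have [n] := ubnP #|S|; elim: n S => // n IHn S Sn.
have := a0 [ffun i => i \in S]; rewrite (bigD1 S) //=.
rewrite big1 => [|i iS]; last by rewrite ffunE iS.
rewrite mulr1 big1 ?addr0 // => T TS.
have [sTS|/fintype.subsetPn[i iT /negPf iS]] := boolP (T \subset S).
  rewrite IHn ?mul0r // -ltnS; apply: leq_ltn_trans Sn.
  by apply: proper_card; rewrite finset.properEneq TS.
by rewrite (bigD1 i) //= ffunE iS mul0r mulr0.
Qed.

Lemma boolean_nullstellensatz l d (h : F2poly l) : (mmeasure mdeg h <= d)%N ->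
  (forall z : bits l, meval (fun i => (z i)%:R) h = 0) ->
  exists2 r : 'I_l -> F2poly l,
    forall i, (mmeasure mdeg ((var i ^+ 2 - var i) * r i)%R <= d)%N &
    h = \sum_i (var i ^+ 2 - var i) * r i.
Proof.
move=> /boolean_reduction[a [r [rd ->]]] h0; exists r => //.
rewrite big1 ?add0r // => S _; rewrite (@multilinear_eq0 _ a) ?scale0r // => z.
have := h0 z; rewrite mevalD !raddf_sum /= [X in _ + X]big1 ?addr0 => [E|i _].
  rewrite -[RHS]E; apply: eq_bigr => T _; rewrite mevalZ rmorph_prod; congr (_ * _).
  by apply: eq_bigr => i _; rewrite /= mevalXU.
by rewrite mevalM mevalB rmorphXn /= mevalXU expr2 F2_mulrr subrr mul0r.
Qed.

(** Converts a certificate indexed by clauses and variables into a tuple indexed by positions in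
    [NS_axioms]. The strict inequality comes from [degree] being one less than [mmeasure mdeg]. *)
Lemma NS_lt l (phi : cnf l) d (q : clause l -> F2poly l) (r : 'I_l -> F2poly l) :
  (0 < d)%N ->
  (forall C, C \in phi -> (mmeasure mdeg (clause_poly C * q C)%R <= d)%N) ->
  (forall i, (mmeasure mdeg ((var i ^+ 2 - var i) * r i)%R <= d)%N) ->
  \sum_(C in phi) clause_poly C * q C + \sum_i (var i ^+ 2 - var i) * r i = 1 ->
  (NS phi < d)%N.
Proof.
move=> d_gt0 qd rd sum1.
pose L : seq (clause l + 'I_l) := map inl (enum phi) ++ map inr (enum 'I_l).
pose axiom (x : clause l + 'I_l) : F2poly l := 
  match x with inl C => clause_poly C | inr i => var i ^+ 2 - var i end.
pose coef (x : clause l + 'I_l) : F2poly l := match x with inl C => q C | inr i => r i end.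
have axE : NS_axioms phi = map axiom L by rewrite /NS_axioms map_cat -!map_comp.
pose x0 : clause l + 'I_l := inl finset.set0.
pose qt := [tuple coef (nth x0 L k) | k < size (NS_axioms phi)].
have Lk (k : 'I_(size (NS_axioms phi))) : (k < size L)%N.
  by rewrite -(size_map axiom) -axE.
have nthE k : (k < size L)%N -> (NS_axioms phi)`_k = axiom (nth x0 L k).
  by move=> kL; rewrite axE (nth_map x0).
have termE (k : 'I_(size (NS_axioms phi))) :
    (NS_axioms phi)`_k * tnth qt k = axiom (nth x0 L k) * coef (nth x0 L k).
  by rewrite tnth_mktuple nthE.
have refq : NS_refutation qt.
  rewrite /NS_refutation (eq_bigr _ (fun k _ => termE k)).
  rewrite -(big_mkord xpredT (fun k => axiom (nth x0 L k) * coef (nth x0 L k))).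
  rewrite [in size _]axE size_map -(big_nth x0 xpredT (fun x => axiom x * coef x)).
  rewrite big_cat !big_map /=.
  by rewrite !big_enum.
have [_ /(_ (NS_refutation_degree qt))] := @min_natP
  [set d | exists2 q, @NS_refutation l phi q & d = NS_refutation_degree q]%classic
  _ (ex_intro2 _ _ qt refq erefl).
move=> /(_ (ex_intro2 _ _ qt refq erefl)) /leq_ltn_trans; apply.
rewrite -(prednK d_gt0) ltnS; apply/bigmax_leqP => k _.
rewrite termE /degree -!subn1 leq_sub2r //.
have : nth x0 L k \in L by rewrite mem_nth.
rewrite mem_cat => /orP[] /mapP[x]; rewrite ?mem_enum => xin ->; first exact: qd.
exact: rd.
Qed.

Lemma mmeasure_prod_le l (I : finType) (A : {pred I}) (f : I -> F2poly l) :
  (forall i, (mmeasure mdeg (f i) <= 2)%N) ->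
  (mmeasure mdeg (\prod_(i in A) f i)%R <= #|A|.+1)%N.
Proof.
move=> f2; rewrite -sum1_card.
apply: (big_ind2 (fun (p : F2poly l) n => (mmeasure mdeg p <= n.+1)%N)).
- by rewrite mmeasure1.
- move=> p a q b pa qb; have [->|p0] := eqVneq p 0; first by rewrite mul0r mmeasure0.
  have [->|q0] := eqVneq q 0; first by rewrite mulr0 mmeasure0.
  rewrite msizeM // -subn1 leq_subLR add1n -addnS -addSn.
  exact: leq_add.
- by move=> i _; apply: f2.
Qed.

Lemma mmeasure_var l (i : 'I_l) : mmeasure mdeg (var i) = 2%N.
Proof. by rewrite /var msizeX mdeg1. Qed.

Lemma mmeasure_1Bvar l (i : 'I_l) : (mmeasure mdeg (1 - var i)%R <= 2)%N.
Proof. by rewrite (leq_trans (mmeasureD_le _ _ _)) // mmeasureN mmeasure1 mmeasure_var. Qed.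

Lemma meval_clause_poly l (C : clause l) (z : bits l) :
  meval (fun i => (z i)%:R) (clause_poly C) = (violated z C)%:R :> 'F_2.
Proof.
rewrite rmorph_prod /=; have [zC|] := boolP (violated z C).
  rewrite big1 // => L LC; rewrite (violated_val zC LC).
  by case zL: (z L.1); rewrite /= ?mevalB ?meval1 mevalXU zL ?subr0.
move=> /forall_inPn[L LC]; rewrite negbK => /eqP zL; rewrite (bigD1 L) //= -zL.
by case zL1: (z L.1); rewrite /= ?mevalB ?meval1 mevalXU zL1 ?subrr mul0r.
Qed.

(** [#|C| + #|T|] bounds the degree of the encoding of [C] times the product over [T]. Products of
    [1 - u i] replace monomials because [violated_expansion] has them in its coefficients. *)
Definition NS_dual_function l (phi : cnf l) (p : bits l -> 'F_2) : Prop :=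
  \sum_u p u = 1 /\
  forall (C : clause l) (T : {set 'I_l}), C \in phi -> (#|C| + #|T| < NS phi)%N ->
    \sum_u p u * (violated u C)%:R * \prod_(i in T) (1 - (u i)%:R) = 0.

(* Linear duality: the functional killing all low-degree multiples of the
   clauses is represented by summation against a function on the cube. *)
Lemma NS_dual l (phi : cnf l) : exists p : bits l -> 'F_2, NS_dual_function phi p.
Proof.
set d := NS phi.
pose g (CT : clause l * {set 'I_l}) (u : bits l) : 'F_2 :=
  ((CT.1 \in phi) && (#|CT.1| + #|CT.2| < d)%N)%:R *
  ((violated u CT.1)%:R * \prod_(i in CT.2) (1 - (u i)%:R)).
have [[a aE]|[p p1 pg]] := fredholm g (fun=> 1); last first.
  exists p; split=> [|C T Cphi CT]; first by rewrite -p1; apply: eq_bigr => u _; rewrite mul1r.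
  rewrite -[RHS](pg (C, T)); apply: eq_bigr => u _.
  by rewrite /g /= Cphi CT mul1r -mulrA mulrC.
have d_gt0 : (0 < d)%N.
  rewrite lt0n; apply/eqP => d0; have := aE [ffun=> false]; rewrite big1 => [/eqP|i _].
    by rewrite oner_eq0.
  by rewrite /g d0 ltn0 andbF mul0r mulr0.
(* The constant 1 is now a combination of low-degree multiples of clauses on the cube; lifting it to
   polynomials will refute [phi] in degree below [d]. *)
pose q (C : clause l) : F2poly l := \sum_(T : {set 'I_l} | (#|C| + #|T| < d)%N)
  a (C, T) *: \prod_(i in T) (1 - var i).
have qd C : (mmeasure mdeg (clause_poly C * q C)%R <= d)%N.
  rewrite mulr_sumr (leq_trans (mmeasure_sum _ _ _ _)) //; apply/bigmax_leqP => T CT.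
  rewrite -scalerAr (leq_trans (mmeasureZ_le _ _ _)) //.
  set P := \prod_(i in T) _.
  have Pd : (mmeasure mdeg P <= #|T|.+1)%N.
    by apply: mmeasure_prod_le => i; apply: mmeasure_1Bvar.
  have Cd : (mmeasure mdeg (clause_poly C) <= #|C|.+1)%N.
    apply: mmeasure_prod_le => L; case: ifP => _; first exact: mmeasure_1Bvar.
    by rewrite mmeasure_var.
  have [->|P0] := eqVneq P 0; first by rewrite mulr0 mmeasure0.
  have [->|C0] := eqVneq (clause_poly C) 0; first by rewrite mul0r mmeasure0.
  rewrite msizeM // -subn1 leq_subLR add1n (leq_trans (leq_add Cd Pd)) //.
  by rewrite addSn addnS ltnS.
(* The defect [h] vanishes on the cube, so Boolean axioms account for it within the same degree. *)
pose h : F2poly l := 1 - \sum_(C in phi) clause_poly C * q C.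
have hd : (mmeasure mdeg h <= d)%N.
  rewrite (leq_trans (mmeasureD_le _ _ _)) // mmeasureN mmeasure1 geq_max d_gt0 /=.
  by rewrite (leq_trans (mmeasure_sum _ _ _ _)) //; apply/bigmax_leqP => C _.
have h0 (z : bits l) : meval (fun i => (z i)%:R) h = 0.
  rewrite mevalB meval1; apply/eqP; rewrite subr_eq0; apply/eqP; rewrite [LHS](aE z).
  transitivity (\sum_(C : clause l) \sum_(T : {set 'I_l}) a (C, T) * g (C, T) z).
    by rewrite pair_bigA; apply: eq_bigr => -[].
  rewrite raddf_sum /=.
  rewrite [LHS](bigID (mem phi)) /= [X in _ + X]big1 ?addr0; last first.
    by move=> C /negPf Cphi; rewrite big1 // => T _; rewrite /g /= Cphi mul0r mulr0.
  apply: eq_bigr => C Cphi.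
  rewrite mevalM meval_clause_poly raddf_sum /= mulr_sumr.
  rewrite [RHS]big_mkcond; apply: eq_bigr => T _; rewrite /g /= Cphi /=.
  case: ifP => _; last by rewrite mul0r mulr0.
  rewrite mevalZ rmorph_prod mul1r mulrCA; congr (_ * (_ * _)).
  by apply: eq_bigr => i _; rewrite /= mevalB meval1 mevalXU.
have [r rd hE] := boolean_nullstellensatz hd h0.
have := @NS_lt l phi d q r d_gt0 (fun C _ => qd C) rd.
by rewrite -hE addrC subrK => /(_ erefl); rewrite ltnn.
Qed.



(** * Semi-monotone composition *)

(* If [l < d], all the coefficients of degree greater than [l - d] vanish, that is,
   all of them. *)
Definition mono_rank (l t d : nat) : nat :=
  if (d <= l)%N then ('C(l, l - d) * (2 ^ t) ^ (l - d))%N else 0%N.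

Lemma bin_le_expn n k : ('C(n, k) <= n ^ k)%N.
Proof.
have ffact_le : forall n, (n ^_ k <= n ^ k)%N.
  elim: k => // k IHk [|m]; first by rewrite ffact0n.
  rewrite ffactSS expnS leq_mul2l /= (leq_trans (IHk m)) //.
  by case: (k) => // j; rewrite leq_exp2r.
by apply: leq_trans (ffact_le n); rewrite -bin_ffact leq_pmulr ?fact_gt0.
Qed.

(** The bound by [(2 ^ t) ^ l] times the [d]-th power of [l / 2 ^ t], with denominators cleared to
    remain in the natural numbers. *)
Lemma mono_rank_le l t d : (mono_rank l t d * (2 ^ t) ^ d <= l ^ d * (2 ^ t) ^ l)%N.
Proof.
rewrite /mono_rank; case: (leqP d l) => [dl|_]; last by rewrite mul0n.
rewrite bin_sub // -mulnA -expnD subnK // leq_mul2r bin_le_expn orbT //.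
Qed.

(** Where [C] is violated, [violated_expansion] turns [p] into a polynomial in the equality
    indicators, and the dual conditions erase its coefficients of degree above [l - NS phi]. *)
Lemma rank_le_lift_eq l t (phi : cnf l) (p : bits l -> 'F_2) (C : clause l)
    (X Y : Type) (f : X -> {ffun 'I_l -> bits t}) (h : Y -> {ffun 'I_l -> bits t})
    (P : pred X) (Q : pred Y) :
  NS_dual_function phi p ->
  (forall x y, P x -> Q y -> search_problem phi [ffun i => f x i == h y i] C) ->
  rank_le (mono_rank l t (NS phi))
    (fun x y => (P x)%:R * lift_eq p (f x) (h y) * (Q y)%:R).
Proof.
move=> [_ pC] PQ.
have [/existsP[z /andP[Cphi zC]]|noC] :=
  boolP [exists z, (C \in phi) && violated z C]; last first.
  (* No assignment can make [C] a solution, so the rectangle is empty. *)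
  apply: rank_le_ext (rank_le0 _ _ _ _) => x y.
  have [Px|] := boolP (P x); last by rewrite !mul0r.
  have [Qy|] := boolP (Q y); last by rewrite mulr0.
  by case/existsP: noC; exists [ffun i => f x i == h y i]; apply/andP/PQ.
pose c (S : {set 'I_l}) : 'F_2 := (S \subset clause_free C)%:R *
  \sum_u p u * (violated u C)%:R * \prod_(i in clause_free C :\: S) (1 - (u i)%:R).
(* Here [T] is [clause_free C] minus [S], so [#|C| + #|T|] equals [l - #|S|], which is below
   [NS phi]. *)
have c0 (S : {set 'I_l}) : (l < #|S| + NS phi)%N -> c S = 0.
  move=> lS; rewrite /c; have [SC|] := boolP (S \subset _); last by rewrite mul0r.
  rewrite pC ?mulr0 // cardsDS // .
  have := card_clause_free zC; have := subset_leq_card SC; lia.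
pose low (x y : {ffun 'I_l -> bits t}) :=
  \sum_(S : {set 'I_l}) c S * \prod_(i in S) (x i == y i)%:R.
have low_rank : rank_le (mono_rank l t (NS phi)) low.
  rewrite /mono_rank; case: (leqP (NS phi) l) => dl; last first.
    apply: rank_le_ext (rank_le0 _ _ _ _) => x y.
    by rewrite /low big1 // => S _; rewrite c0 ?mul0r // ltn_addl.
  have cards : #|bits t| = (2 ^ t)%N by rewrite card_ffun card_bool card_ord.
  rewrite -cards; apply: rank_le_low_degree => [||].
  - exact: [ffun=> false].
  - by move=> S; rewrite ltn_subLR // addnC; apply: c0.
  - exact: leq_subr.
have := rank_le_scale (fun x => (P x)%:R) (fun y => (Q y)%:R) (rank_le_comp f h low_rank).
apply: rank_le_ext => x y.
have [Px|] := boolP (P x); last by rewrite !mul0r.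
have [Qy|] := boolP (Q y); last by rewrite !mulr0.
have [_ viol] := PQ x y Px Qy; rewrite !mul1r !mulr1 /lift_eq (violated_expansion p viol).
by apply: eq_bigr => S _; congr (_ * _); apply: eq_bigr => i _; rewrite ffunE.
Qed.

Lemma composition_rank_bound m n t l (g : bits n -> bool) (phi : cnf l)
    (pi : protocol 'M[bool]_(m, n) 'M[bool]_(m, n) ('I_m * 'I_n)) :
  (0 < t)%N ->
  injectively_reduces (lifted_search (search_problem phi) (eq_gadget t)) (mKW g) ->
  solves pi (U_mKW_promise m g) (U_mKW m g) ->
  (2 ^ m * ((2 ^ t) ^ l) ^ m <= ((2 ^ t) ^ l) ^ m +
     2 * (mono_rank l t (NS phi) * ((2 ^ t) ^ l) ^ m.-1) * leaves pi)%N.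
Proof.
move=> t_gt0 [RA [RB [Rout [red _ _]]]] pi_solves.
have [p p_dual] := NS_dual phi; have [p1 _] := p_dual.
set D := ((2 ^ t) ^ l)%N; set r := mono_rank _ _ _.
pose V := {ffun 'I_l -> bits t}.
have cardV : #|{: V}| = D by rewrite !card_ffun card_bool !card_ord.
pose T := (bool * V)%type.
pose row (s : T) : bits n := if s.1 then val (RA s.2) else val (RB s.2).
have g_row s : g (row s) = s.1.
  by rewrite /row; case: ifP => _; [apply: (valP (RA _)) | apply/negbTE/(valP (RB _))].
pose N (s s' : T) : 'F_2 :=
  if s.1 == s'.1 then (s.2 == s'.2)%:R else lift_eq p s.2 s'.2.
have N_rank : rank_le D N.
  (* The block column of [I] and [A] times the block row of [I] and [A]; the remaining diagonal
     block is the square of [A], which is [I]. *)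
  rewrite -cardV; apply: (rank_le_fin
    (u := fun s w => if s.1 then (s.2 == w)%:R else lift_eq p s.2 w)
    (v := fun w s => if s.1 then (w == s.2)%:R else lift_eq p w s.2)) => -[b x] [b' y].
  rewrite /N /=; case: b b' => [] [] /=.
  - by under eq_bigr => w _ do rewrite mulrC; rewrite sum_delta eq_sym.
  - by under eq_bigr => w _ do rewrite mulrC; rewrite sum_delta.
  - by under eq_bigr => w _ do rewrite eq_sym; rewrite sum_delta.
  - by rewrite lift_eq_involutive.
pose Idx := {ffun 'I_m -> T}.
pose mat (X : Idx) : 'M[bool]_(m, n) := \matrix_(i, j) row (X i) j.
have mat_rows X : apply_rows g (mat X) = [ffun i => (X i).1].
  apply/ffunP => i; rewrite !ffunE -g_row; congr g.
  by apply/ffunP => j; rewrite !ffunE mxE.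
pose NN (X Y : Idx) : 'F_2 := \prod_i N (X i) (Y i).
pose M (X Y : Idx) : 'F_2 := NN X Y - (X == Y)%:R.
have M_leaf (P Q : pred Idx) (o : 'I_m * 'I_n) :
    (forall X Y, P X -> Q Y -> [/\ true, true & run pi (mat X) (mat Y) = o]) ->
    rank_le (2 * (r * D ^ m.-1)) (fun X Y => (P X)%:R * M X Y * (Q Y)%:R).
  case: o => i j leafE.
  have sol X Y : P X -> Q Y -> [ffun k => (X k).1] <> [ffun k => (Y k).1] :> bits m ->
     [\/ ((X i).1 && ~~ (Y i).1) && (row (X i) j && ~~ row (Y i) j),
      (~~ (X i).1 && (Y i).1) && (~~ row (X i) j && row (Y i) j) |
      ((X i).1 == (Y i).1) && (row (X i) j != row (Y i) j)].
    move=> PX QY XY; have [_ _ oE] := leafE _ _ PX QY.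
    have := pi_solves (mat X) (mat Y); rewrite /U_mKW_promise !mat_rows => /(_ XY).
    by rewrite oE /U_mKW !mat_rows !ffunE !mxE.
  pose rest (X Y : Idx) := \prod_(k | k != i) N (X k) (Y k).
  have rest_rank : rank_le (D ^ m.-1) rest.
    have := rank_le_prod (P := fun k => k != i) (fun k _ =>
      rank_le_comp (fun X : Idx => X k) (fun Y : Idx => Y k) N_rank).
    by rewrite prod_nat_const cardC1 card_ord.
  (* The two orientations of [a_i <> b_i] give two subrectangles carrying all of [M] on this leaf,
     whence the factor 2. *)
  pose P1 X := [&& P X, (X i).1 & row (X i) j].
  pose Q1 Y := [&& Q Y, ~~ (Y i).1 & ~~ row (Y i) j].
  pose P0 X := [&& P X, ~~ (X i).1 & ~~ row (X i) j].
  pose Q0 Y := [&& Q Y, (Y i).1 & row (Y i) j].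
  have rank1 : rank_le r (fun X Y : Idx => (P1 X)%:R * lift_eq p (X i).2 (Y i).2 * (Q1 Y)%:R).
    apply: (rank_le_lift_eq (C := Rout j) (f := fun X : Idx => (X i).2)
      (h := fun Y : Idx => (Y i).2) p_dual) => X Y /and3P[_ X1 Xj] /and3P[_ Y0 Yj].
    apply: (red _ _ j); split; first by move: Xj; rewrite /row X1.
    by move: Yj; rewrite /row (negbTE Y0) => /negbTE.
  have rank0 : rank_le r (fun X Y : Idx => (P0 X)%:R * lift_eq p (X i).2 (Y i).2 * (Q0 Y)%:R).
    apply: (rank_le_lift_eq (C := Rout j) (f := fun X : Idx => (X i).2)
      (h := fun Y : Idx => (Y i).2) p_dual) => X Y /and3P[_ X0 Xj] /and3P[_ Y1 Yj].
    (* In this orientation the row of [Y] comes from [RA] and that of [X] from [RB], so the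
       arguments of equality are exchanged. *)
    have -> : [ffun k => (X i).2 k == (Y i).2 k] =
        [ffun k => eq_gadget t ((Y i).2 k) ((X i).2 k)].
      by apply/ffunP => k; rewrite !ffunE eq_sym.
    apply: (red _ _ j); split; first by move: Yj; rewrite /row Y1.
    by move: Xj; rewrite /row (negbTE X0) => /negbTE.
  rewrite mul2n -addnn.
  apply: rank_le_ext (rank_leD (rank_leM rank1 rest_rank) (rank_leM rank0 rest_rank)) => X Y.
  rewrite /P1 /P0 /Q1 /Q0.
  have [PX|_] := boolP (P X); last by rewrite !mul0r addr0.
  have [QY|_] := boolP (Q Y); last by rewrite !mulr0 !mul0r addr0.
  have {}sol := sol X Y PX QY; rewrite !andTb mul1r mulr1.
  have NNE : NN X Y = N (X i) (Y i) * rest X Y by rewrite /NN (bigD1 i).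
  have [Xi_Yi|Xi_Yi] := eqVneq (X i).1 (Y i).1.
    (* If all row labels agree, the tensor product is itself the identity entry. Otherwise the
       output forces the [i]-th rows to differ, and both terms of [M] vanish. *)
    have -> : M X Y = 0.
      have [XY|/eqP XY] := eqVneq [ffun k => (X k).1] ([ffun k => (Y k).1] : bits m).
        apply/eqP; rewrite subr_eq0; apply/eqP; rewrite -prod_delta; apply: eq_bigr => k _.
        move/ffunP/(_ k): XY; rewrite !ffunE /N => XYk; rewrite XYk eqxx -pair_eqE /=.
        by rewrite /pair_eq XYk eqxx.
      have {}sol : X i != Y i.
        case: (sol XY); rewrite Xi_Yi; first by rewrite andbN.
        - by rewrite andNb.
        - by rewrite eqxx /=; apply: contraNneq => ->.
      rewrite /M NNE /N Xi_Yi eqxx.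
      have /negPf -> : (X i).2 != (Y i).2.
        by apply: contraNneq sol => XY2; apply/eqP/eqP;
          rewrite -pair_eqE /pair_eq Xi_Yi XY2 !eqxx.
      have /negPf -> : X != Y by apply: contraNneq sol => ->.
      by rewrite mul0r subr0.
    by rewrite Xi_Yi; case: (Y i).1; rewrite /= ?(mul0r, mulr0, addr0).
  have XY : [ffun k => (X k).1] <> [ffun k => (Y k).1] :> bits m.
    by move=> /ffunP/(_ i); rewrite !ffunE; apply/eqP.
  have -> : M X Y = lift_eq p (X i).2 (Y i).2 * rest X Y.
    rewrite /M NNE /N (negbTE Xi_Yi).
    have /negPf -> : X != Y by apply: contraNneq Xi_Yi => ->.
    by rewrite subr0.
  case: (sol XY) => /andP[]; last by rewrite (negbTE Xi_Yi).
    by move=> /andP[-> ->] /andP[-> ->]; rewrite /= !(mul0r, mulr0, mul1r, mulr1, addr0).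
  by move=> /andP[-> ->] /andP[-> ->]; rewrite /= !(mul0r, mulr0, mul1r, mulr1, add0r).
have M_rank := rank_le_leaves (P := predT) (Q := predT) M_leaf.
have NN_rank : rank_le (D ^ m) NN.
  have := rank_le_prod (P := predT) (fun k _ =>
    rank_le_comp (fun X : Idx => X k) (fun Y : Idx => Y k) N_rank).
  by rewrite prod_nat_const card_ord.
have : rank_le (D ^ m + 2 * (r * D ^ m.-1) * leaves pi) (fun X Y : Idx => (X == Y)%:R : 'F_2).
  apply: rank_le_ext (rank_leD NN_rank (rank_le_scale (fun=> -1) (fun=> 1) M_rank)) => X Y.
  by rewrite /M /=; ring.
by move/rank_le_delta; rewrite card_ffun card_prod card_bool cardV card_ord expnMn.
Qed.

Lemma composition_leaves m n t l (g : bits n -> bool) (phi : cnf l)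
    (pi : protocol 'M[bool]_(m, n) 'M[bool]_(m, n) ('I_m * 'I_n)) :
  (0 < t)%N ->
  injectively_reduces (lifted_search (search_problem phi) (eq_gadget t)) (mKW g) ->
  solves pi (U_mKW_promise m g) (U_mKW m g) ->
  (2 ^ m * (2 ^ t) ^ NS phi <= 4 * l ^ NS phi * leaves pi)%N.
Proof.
move=> t_gt0 red pi_solves.
(* Some leaf of [pi] carries an output in ['I_m * 'I_n], which rules out [m = 0]. *)
have m_gt0 : (0 < m)%N.
  have [ij] : inhabited ('I_m * 'I_n)%type.
    by clear pi_solves; elim: pi => // o; constructor.
  exact: leq_ltn_trans (ltn_ord ij.1).
have := composition_rank_bound t_gt0 red pi_solves.
clear pi_solves; case: m m_gt0 pi => // m _ pi.
set D := ((2 ^ t) ^ l)%N; set Q := ((2 ^ t) ^ NS phi)%N; set L := leaves pi.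
have D_gt0 : (0 < D)%N by rewrite !expn_gt0.
have := mono_rank_le l t (NS phi); rewrite -/D -/Q; set r := mono_rank _ _ _ => rQ.
have -> : (2 ^ m.+1 * D ^ m.+1 = D ^ m * (2 ^ m.+1 * D))%N
  by rewrite [(D ^ m.+1)%N]expnS mulnA mulnC.
have -> : (D ^ m.+1 + 2 * (r * D ^ m) * L = D ^ m * (D + 2 * r * L))%N.
  by rewrite expnS; move: (D ^ m)%N => Dm; ring.
rewrite leq_pmul2l ?expn_gt0 ?D_gt0 // => bound.
have {}bound : (D * (2 ^ m.+1 * Q) <= D * (Q + 2 * l ^ NS phi * L))%N.
  rewrite mulnCA mulnA; apply: (leq_trans (leq_mul bound (leqnn Q))).
  rewrite mulnDl mulnDr leq_add2l.
  have := leq_mul (leqnn (2 * L)%N) rQ; move: (l ^ NS phi)%N => ld.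
  by congr (is_true (leq _ _)); ring.
(* What remains is [2 * 2 ^ m * Q <= Q + 2 * l ^ NS phi * L]. Absorbing [Q] into [2 ^ m * Q] costs
   half of the left side, which doubles the constant 2 to 4. *)
move: bound; rewrite leq_pmul2l // expnS.
have : (Q <= 2 ^ m * Q)%N by rewrite leq_pmull ?expn_gt0.
rewrite -!mulnA; lia.
Qed.

(** * Passage to logarithms *)

Lemma log_leaves (R : realType) (m t l d L : nat) :
  (0 < d)%N -> (8 <= d * t)%N -> 2 * log2 (l%:R : R) <= t%:R ->
  (2 ^ m * (2 ^ t) ^ d <= 4 * l ^ d * L)%N ->
  (m%:R + 4^-1 * (d * t)%:R) * ln 2 <= ln (L%:R : R).
Proof.
move=> d_gt0 dt8 lt bound.
have pos_lhs : (0 < 2 ^ m * (2 ^ t) ^ d)%N by rewrite muln_gt0 !expn_gt0.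
have := leq_trans pos_lhs bound; rewrite !muln_gt0 /= => /andP[ld_gt0 L_gt0].
have l_gt0 : (0 < l)%N by move: ld_gt0; rewrite expn_gt0 eqn0Ngt d_gt0 orbF.
have ln2_gt0 : 0 < ln (2 : R) by rewrite ln_gt0 // ltr1n.
have {lt} : 2 * ln (l%:R : R) <= t%:R * ln 2.
  by move: lt; rewrite /log2 mulrA ler_pdivrMr.
have : ln ((2 ^ m * (2 ^ t) ^ d)%:R : R) <= ln ((4 * l ^ d * L)%:R : R).
  by rewrite ler_ln ?posrE ?ltr0n ?ler_nat // (leq_trans pos_lhs).
rewrite [ln (2 ^ m * _)%:R](_ : _ = m%:R * ln 2 + (d * t)%:R * ln 2); last first.
  rewrite natrM !natrX -exprM lnM ?posrE ?exprn_gt0 // !lnXn // mulnC.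
  by rewrite -!(mulr_natl (ln 2)).
rewrite [ln (4 * l ^ d * L)%:R](_ : _ = 2 * ln 2 + d%:R * ln l%:R + ln L%:R); last first.
  rewrite !natrM natrX !lnM ?posrE ?mulr_gt0 ?exprn_gt0 ?ltr0n //.
  rewrite (_ : 4%:R = 2 ^+ 2 :> R); last by rewrite -natrX.
  by rewrite !lnXn ?ltr0n // -(mulr_natl (ln 2)) -(mulr_natl (ln l%:R)).
move=> bound_ln lt; have {lt} : d%:R * (2 * ln (l%:R : R)) <= d%:R * (t%:R * ln 2).
  by rewrite ler_wpM2l.
(* Of the gain [d * t], half pays for [d * log l], a quarter pays for the logarithm of 4 since
   [8 <= d * t], and a quarter remains. *)
have : 8 * ln 2 <= (d * t)%:R * ln (2 : R) by rewrite ler_pM2r // ler_nat.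
by move: bound_ln; rewrite natrM; lra.
Qed.

Theorem theorem4p1 (R : realType) :
  exists kappa N0 : R, 0 < kappa /\
    forall (m n t l : nat) (g : bits n -> bool) (phi : cnf l),
      non_constant g ->
      monotone g ->
      contradiction phi ->
      injectively_reduces (lifted_search (search_problem phi) (eq_gadget t)) (mKW g) ->
      2 * log2 (l%:R : R) <= t%:R ->
      N0 <= (NS phi * t)%:R ->
      ((m%:R + kappa * (NS phi * t)%:R)%:E <=
         elog2 (leaf_complexity R (U_mKW_promise m g) (U_mKW m g)))%E.
Proof.
exists 4^-1, 8; split=> [|m n t l g phi _ _ _ red lt]; first by rewrite invr_gt0.
rewrite ler_nat => dt8; set c := m%:R + _; set LC := leaf_complexity _ _ _.
have d_gt0 : (0 < NS phi)%N by move: dt8; case: (NS phi).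
have t_gt0 : (0 < t)%N by move: dt8; case: (t); rewrite ?muln0.
have ln2_gt0 : 0 < ln (2 : R) by rewrite ln_gt0 // ltr1n.
have LC_ge : ((expR (c * ln 2))%:E <= LC)%E.
  (* The bound is proved for each protocol in exponential form, so it passes to the infimum,
     including the value [+oo], before the logarithm is taken. *)
  apply: le_ereal_inf_tmp => _ [pi pi_solves ->]; rewrite lee_fin.
  have bound := composition_leaves t_gt0 red pi_solves.
  have L_gt0 : (0 < leaves pi)%N.
    by have := bound; case: leaves => //; rewrite muln0 leqn0 muln_eq0 !expn_eq0.
  rewrite -[leRHS]lnK ?posrE ?ltr0n // ler_expR.
  exact: log_leaves bound.
have -> : c%:E = ((c * ln 2)%:E * ((ln 2)^-1)%:E)%E by rewrite -EFinM mulfK // gt_eqF.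
apply: lee_wpmul2r; first by rewrite lee_fin invr_ge0 ltW.
rewrite -[c * _]expRK -lne_EFin ?expR_gt0 // lee_lne // in_itv /= leey andbT.
  by rewrite lee_fin ltW ?expR_gt0.
by apply: le_trans LC_ge; rewrite lee_fin ltW ?expR_gt0.
Qed.
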